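(* Let $\mathcal F$ be a finite pure simplicial complex that is partitionable, and let $q$ be a positive integer. Then $\mathcal F*[q]$ is a partitionable simplicial complex.
   Context: $[q]$ is the $0$-dimensional simplicial complex with $q$ vertices (disjoint from those of $\mathcal F$); the join is $\mathcal F*\mathcal K=\{\sigma\cup\tau:\sigma\in\mathcal F\cup\{\emptyset\},\tau\in\mathcal K\cup\{\emptyset\}\}$. A pure simplicial complex $\mathcal F$ is partitionable if there is an exact facing, i.e. a map $\varphi:\mathrm{facets}(\mathcal F)\to\mathcal F$ (faces including $\emptyset$) such that for every face $\sigma\in\mathcal F$ there is a unique facet $\tau$ with $\varphi(\tau)\subseteq\sigma\subseteq\tau$. *)

(* Defs.v *)
From mathcomp Require Import all_boot.

Set Implicit Arguments.
Unset Strict Implicit.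
Unset Printing Implicit Defensive.

(* A finite simplicial complex is the set of its faces, over an ambient finite
   type T; an element v of T need not be a vertex. The empty set is a face. *)
Definition simplicial_complex (T : finType) (F : {set {set T}}) : Prop :=
  set0 \in F /\
  (forall s t : {set T}, s \in F -> t \subset s -> t \in F).

Definition vertices (T : finType) (F : {set {set T}}) : {set T} :=
  [set v | [set v] \in F].

Definition facets (T : finType) (F : {set {set T}}) : {set {set T}} :=
  [set t | maxset (fun s => s \in F) t].

Definition pure (T : finType) (F : {set {set T}}) : Prop :=
  {in facets F &, forall s t : {set T}, #|s| = #|t|}.

(* Only the values of phi on facets F matter. *)
Definition exact_facing (T : finType) (F : {set {set T}})
    (phi : {set T} -> {set T}) : Prop :=
  {in facets F, forall t : {set T}, phi t \in F} /\
  {in F, forall s : {set T},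
     exists! t : {set T},
       [/\ t \in facets F, phi t \subset s & s \subset t]}.

Definition partitionable (T : finType) (F : {set {set T}}) : Prop :=
  exists phi : {set T} -> {set T}, exact_facing F phi.

(* Meant for complexes on disjoint vertex sets. *)
Definition complex_join (T : finType) (F K : {set {set T}}) : {set {set T}} :=
  [set s :|: t | s in set0 |: F, t in set0 |: K].

(* The complex whose vertex set is Q and which has no other nonempty face;
   it is the complex [q] when #|Q| = q. *)
Definition discrete_complex (T : finType) (Q : {set T}) : {set {set T}} :=
  set0 |: [set [set v] | v in Q].

(* Main.v *)
Require Import Defs.
From mathcomp Require Import all_boot.

Set Implicit Arguments.
Unset Strict Implicit.
Unset Printing Implicit Defensive.

(** Fix [v0] in [Q]. A face [s] of the join splits as [s :\: Q], a face of [F],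
    and [s :&: Q], which has at most one element; facets are the faces with
    [s :\: Q] a facet of [F] and [s :&: Q] a singleton. If [phi] is an exact
    facing of [F], then [t :|: [set v0] |-> phi t] and
    [t :|: [set v] |-> phi t :|: [set v]], for [v != v0], is an exact facing of
    the join: the singleton [[set v0]] takes care of both the faces avoiding [Q]
    and the faces containing [v0]. *)

Lemma setUI_disjoint (T : finType) (A R Q : {set T}) :
  [disjoint A & Q] -> R \subset Q -> (A :|: R) :&: Q = R.
Proof.
move=> dAQ sRQ; rewrite setIUl (setIidPl sRQ).
by move: dAQ; rewrite -setI_eq0 => /eqP->; rewrite set0U.
Qed.

Lemma setUD_disjoint (T : finType) (A R Q : {set T}) :
  [disjoint A & Q] -> R \subset Q -> (A :|: R) :\: Q = A.
Proof.
move=> /setDidPl dAQ; rewrite -setD_eq0 setDUl dAQ => /eqP->.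
by rewrite setU0.
Qed.

(** Faces are closed under subsets, so each element of a face is a vertex. *)
Lemma face_disjoint (T : finType) (F : {set {set T}}) (Q s : {set T}) :
  simplicial_complex F -> [disjoint Q & vertices F] -> s \in F ->
  [disjoint s & Q].
Proof.
move=> [_ Fdown] dQ sF; rewrite disjoint_sym disjoint_subset.
apply/subsetP=> x xQ; rewrite inE; apply: contraL xQ => xs.
rewrite (disjointFl dQ) // inE.
by apply: Fdown sF _; rewrite sub1set.
Qed.

Lemma mem_join_discrete (T : finType) (F : {set {set T}}) (Q s : {set T}) :
  simplicial_complex F -> [disjoint Q & vertices F] ->
  (s \in complex_join F (discrete_complex Q)) =
  (s :\: Q \in F) && (#|s :&: Q| <= 1).
Proof.
move=> FC dQ; have [F0 Fdown] := FC.
have F0U : set0 |: F = F by apply/setUidPr; rewrite sub1set.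
apply/imset2P/andP => [[a r aF rK ->] | [sF s1]].
  rewrite F0U in aF; have daQ := face_disjoint FC dQ aF.
  have [rQ r1] : r \subset Q /\ #|r| <= 1.
    (* The empty set arises twice, from [complex_join] and from [discrete_complex]. *)
    move: rK; rewrite !inE => /orP[/eqP->|/orP[/eqP->|/imsetP[v vQ ->]]].
    - by rewrite sub0set cards0.
    - by rewrite sub0set cards0.
    - by rewrite sub1set cards1.
  by rewrite setUD_disjoint // setUI_disjoint.
exists (s :\: Q) (s :&: Q); rewrite ?F0U //; last by rewrite setUC setID.
rewrite !inE; move: s1; rewrite leq_eqVlt ltnS leqn0 cards_eq0.
case/orP=> [/cards1P[v sv]|->] //.
apply/orP; right; apply/orP; right; rewrite sv; apply: imset_f.
by apply: (subsetP (subsetIr s Q)); rewrite sv set11.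
Qed.

Lemma mem_facets_join_discrete (T : finType) (F : {set {set T}})
    (Q s : {set T}) :
  simplicial_complex F -> [disjoint Q & vertices F] -> 0 < #|Q| ->
  (s \in facets (complex_join F (discrete_complex Q))) =
  (s :\: Q \in facets F) && (#|s :&: Q| == 1).
Proof.
move=> FC dQ /card_gt0P[v0 v0Q].
have memJ := fun u => mem_join_discrete u FC dQ.
rewrite !inE; apply/maxsetP/andP => [[] | [/maxsetP[sF smax] s1]].
  rewrite memJ => /andP[sF s1] smax; split.
    (* A face [B] of [F] above [s :\: Q] enlarges [s] to the face [B :|: (s :&: Q)]. *)
    apply/maxsetP; split=> // B BF sB.
    have dBQ := face_disjoint FC dQ BF.
    rewrite -(smax (B :|: (s :&: Q))) ?setUD_disjoint ?subsetIr //.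
      by rewrite memJ setUD_disjoint ?setUI_disjoint ?subsetIr ?BF.
    by rewrite -{1}(setID s Q) setUC setSU.
  (* If [s] avoided [Q], adding [v0] would give a strictly larger face. *)
  rewrite eqn_leq s1 card_gt0; apply/negP=> /eqP s0.
  have v0s : v0 \notin s.
    by apply/negP=> v0s; have := in_set0 v0; rewrite -s0 inE v0s v0Q.
  have dsQ := face_disjoint FC dQ sF.
  have sE : s :\: Q = s by rewrite -[RHS](setID s Q) s0 set0U.
  rewrite sE in dsQ sF.
  have sv : s :|: [set v0] = s.
    apply: smax; last exact: subsetUl.
    by rewrite memJ setUD_disjoint ?setUI_disjoint ?sub1set // sF cards1.
  by move: v0s; rewrite -sv !inE eqxx orbT.
split; first by rewrite memJ sF (eqP s1).
move=> B; rewrite memJ => /andP[BF B1] sB.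
(* Outside [Q] equality comes from maximality in [F], inside [Q] from cardinality. *)
rewrite -(setID B Q) -(setID s Q); congr (_ :|: _); last first.
  by apply: smax => //; apply: setSD.
by apply/esym/eqP; rewrite eqEcard setSI //= (eqP s1).
Qed.

Lemma complex_join_discrete (T : finType) (F : {set {set T}}) (Q : {set T}) :
  simplicial_complex F -> [disjoint Q & vertices F] ->
  simplicial_complex (complex_join F (discrete_complex Q)).
Proof.
move=> FC dQ; have [F0 Fdown] := FC; split.
  by rewrite mem_join_discrete // set0D set0I F0 cards0.
move=> s t; rewrite !mem_join_discrete // => /andP[sF s1] ts.
by rewrite (Fdown _ _ sF) ?setSD //= (leq_trans _ s1) // subset_leq_card ?setSI.
Qed.

(** Each facet has exactly one more element than a facet of [F]. *)
Lemma pure_join_discrete (T : finType) (F : {set {set T}}) (Q : {set T}) :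
  simplicial_complex F -> [disjoint Q & vertices F] -> 0 < #|Q| ->
  pure F -> pure (complex_join F (discrete_complex Q)).
Proof.
move=> FC dQ Q0 Fpure s t; rewrite !mem_facets_join_discrete //.
move=> /andP[sF /eqP s1] /andP[tF /eqP t1].
by rewrite -(cardsID Q s) -(cardsID Q t) s1 t1 (Fpure _ _ sF tF).
Qed.

Lemma partitionable_join_discrete (T : finType) (F : {set {set T}})
    (Q : {set T}) :
  simplicial_complex F -> [disjoint Q & vertices F] -> 0 < #|Q| ->
  partitionable F -> partitionable (complex_join F (discrete_complex Q)).
Proof.
move=> FC dQ Q0 [phi [phiF phiU]]; have /card_gt0P[v0 v0Q] := Q0.
have subQ (A B : {set T}) :
    (A \subset B) = (A :\: Q \subset B :\: Q) && (A :&: Q \subset B :&: Q).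
  apply/idP/andP => [AB | [AB1 AB2]]; first by rewrite setSD ?setSI.
  by rewrite -(setID A Q) -(setID B Q) setUSS.
(* One formula covers both cases: deleting [v0] empties [[set v0]] and leaves any other singleton
   unchanged. *)
pose psi u := phi (u :\: Q) :|: ((u :&: Q) :\ v0).
have sub_Q u : (u :&: Q) :\ v0 \subset Q.
  by apply: subset_trans (subsetDl _ _) (subsetIr _ _).
(* Only on facets is [phi] known to take values in [F], hence to avoid [Q]. *)
have psiD u : u :\: Q \in facets F -> psi u :\: Q = phi (u :\: Q).
  by move=> uF; rewrite setUD_disjoint ?(face_disjoint FC dQ (phiF _ uF)).
have psiI u : u :\: Q \in facets F -> psi u :&: Q = (u :&: Q) :\ v0.
  by move=> uF; rewrite setUI_disjoint ?(face_disjoint FC dQ (phiF _ uF)).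
exists psi; split=> [u | s].
  rewrite mem_facets_join_discrete // mem_join_discrete //.
  move=> /andP[uF /eqP u1]; rewrite psiD // psiI // phiF //=.
  by rewrite -u1 subset_leq_card ?subsetDl.
rewrite mem_join_discrete // => /andP[sF s1].
have [t [[tF phits st] tU]] := phiU _ sF.
have dtQ : [disjoint t & Q].
  by move: tF; rewrite inE => /maxsetP[/(face_disjoint FC dQ)].
(* [R] is the [Q]-part of the facet assigned to [s]; faces avoiding [Q] go to [v0]. *)
pose R := if s :&: Q == set0 then [set v0] else s :&: Q.
have RQ : R \subset Q.
  by rewrite /R; case: ifP => _; rewrite ?sub1set ?subsetIr.
have R1 : #|R| = 1.
  rewrite /R; case: ifPn => [_|]; first by rewrite cards1.
  by rewrite -card_gt0 => s0; apply/eqP; rewrite eqn_leq s1.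
have tD : (t :|: R) :\: Q = t by rewrite setUD_disjoint.
have tI : (t :|: R) :&: Q = R by rewrite setUI_disjoint.
exists (t :|: R); split=> [|u [uJ]].
  split; first by rewrite mem_facets_join_discrete // tD tI tF R1.
    rewrite subQ psiD ?psiI ?tD ?tI // phits /R.
    case: ifP => _; last exact: subsetDl.
    by rewrite setDv sub0set.
  rewrite subQ tD tI st /R.
  by case: eqP => [->|_]; [exact: sub0set | exact: subxx].
move: uJ; rewrite mem_facets_join_discrete // => /andP[uF /eqP u1].
rewrite [psi u \subset s]subQ [s \subset u]subQ psiD // psiI //.
move=> /andP[phius us] /andP[su sIu].
(* Uniqueness for [phi] forces [u :\: Q] to be [t]; it remains to identify [u :&: Q] with [R]. *)
rewrite (tU _ (And3 uF phius su)) setUC -[RHS](setID u Q); congr (_ :|: _).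
(* Both are singletons. If [s] meets [Q], then [s :&: Q] lies in [u :&: Q]; otherwise
   [psi u \subset s] leaves only [v0] for [u :&: Q]. *)
apply/eqP; rewrite eqEcard u1 R1 leqnn andbT /R; case: eqP => // s0.
move: us; rewrite s0 subset0 setD_eq0 => uv0.
by rewrite -(_ : u :&: Q = [set v0]) //; apply/eqP; rewrite eqEcard uv0 cards1 u1.
Qed.

Theorem theorem4p6 (T : finType) (F : {set {set T}}) (q : nat) (Q : {set T})
    (F_complex : simplicial_complex F) (F_pure : pure F)
    (F_part : partitionable F)
    (q_gt0 : 0 < q) (card_Q : #|Q| = q) (dis_Q : [disjoint Q & vertices F]) :
  [/\ simplicial_complex (complex_join F (discrete_complex Q)),
      pure (complex_join F (discrete_complex Q)) &
      partitionable (complex_join F (discrete_complex Q))].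
Proof.
rewrite -card_Q in q_gt0; split.
- exact: complex_join_discrete.
- exact: pure_join_discrete.
- exact: partitionable_join_discrete.
Qed.
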